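(* Let $P=(A^\exists, A^\forall, \mathbf{b}^\exists, \mathbf{b}^\forall, \mathbf{c}, \mathcal{L}, \mathbf{Q})$ be a feasible quantified integer program (QIP) with polyhedral uncertainty, with optimal value $\tilde{z}_P$. Let $\emptyset\neq S\subseteq\mathcal{L}_\forall$, and let $R$ be the $S$-relaxation of $P$, with optimal value $\tilde{z}_R$. Then $\tilde{z}_R$ is a lower bound on the optimal value of $P$, i.e. $\tilde{z}_R\le\tilde{z}_P$.
   Context: Vectors are in bold and $\mathbf{c}\mathbf{x}$ denotes the scalar product. **Data of a QIP with polyhedral uncertainty.** There are $n$ ordered variables $x_1,\dots,x_n$. Each $x_j$ has a bounded domain $\mathcal{L}_j=\{y\in\mathbb{Z}\mid l_j\le y\le u_j\}\neq\emptyset$ with finite rational bounds $l_j,u_j$, and $\mathcal{L}=\{\mathbf{y}\in\mathbb{Z}^n\mid y_j\in\mathcal{L}_j \text{ for all } j\in\{1,\dots,n\}\}$. The set $\mathcal{L}_{relax}=\{\mathbf{y}\in\mathbb{R}^n\mid l_j\le y_j\le u_j \text{ for all } j\}$ is $\mathcal{L}$ without the integrality condition. $\mathbf{Q}\in\{\exists,\forall\}^n$ is the vector of quantifiers; a variable $x_j$ is existential if $Q_j=\exists$ and universal if $Q_j=\forall$. Each maximal consecutive subsequence of identical quantifiers is a block; $\beta$ is the number of blocks, $Q^{(i)}$ is the quantifier of block $i$, and $\mathbf{x}^{(i)}$, $\mathbf{c}^{(i)}$, $\mathcal{L}^{(i)}$, $\mathcal{L}_{relax}^{(i)}$ are the parts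 of $\mathbf{x}$, $\mathbf{c}$, $\mathcal{L}$, $\mathcal{L}_{relax}$ belonging to block $i$. It is assumed that $Q^{(1)}=Q^{(\beta)}=\exists$. $\mathbf{c}\in\mathbb{Q}^n$; $A^\exists\mathbf{x}\le\mathbf{b}^\exists$ (existential constraint system) and $A^\forall\mathbf{x}\le\mathbf{b}^\forall$ (universal constraint system) are finite systems of linear inequalities with rational data. The columns of $A^\forall$ belonging to existential variables are zero, so the universal system restricts only universal variables. For $\mathbf{x}\in\mathbb{R}^n$, $\mathbf{x}_\exists$ and $\mathbf{x}_\forall$ denote the subvectors of existential and universal variables. **Uncertainty set and legal plays.** Let $\mathcal{D}=\{\mathbf{x}\in\mathcal{L}\mid A^\forall\mathbf{x}\le\mathbf{b}^\forall\}$. The uncertainty set is $\mathcal{L}_\forall=\{\mathbf{x}_\forall\mid\mathbf{x}\in\mathcal{D}\}$, assumed nonempty; its elements are called scenarios. For given $\tilde{\mathbf{x}}^{(1)},\dots,\tilde{\mathbf{x}}^{(i-1)}$, the domain of block $i$ is $$\mathcal{D}^{(i)}(\tilde{\mathbf{x}}^{(1)},\dots,\tilde{\mathbf{x}}^{(i-1)})=\begin{cases}\mathcal{L}^{(i)} & \text{if } Q^{(i)}=\exists,\\ \{\mathbf{y}\in\mathcal{L}^{(i)}\mid \exists\,\mathbf{x}=(\tilde{\mathbf{x}}^{(1)},\dots,\tilde{\mathbf{x}}^{(i-1)},\mathbf{y},\mathbf{x}^{(i+1)},\dots,\mathbf{x}^{(\beta)})\in\mathcal{D}\} & \text{if } Q^{(i)}=\forall.\end{cases}$$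 **The problem $P$.** The QIP with polyhedral uncertainty $P$ is $$\min_{\mathbf{x}^{(1)}\in\mathcal{D}^{(1)}}\Big(\mathbf{c}^{(1)}\mathbf{x}^{(1)}+\max_{\mathbf{x}^{(2)}\in\mathcal{D}^{(2)}}\Big(\mathbf{c}^{(2)}\mathbf{x}^{(2)}+\min_{\mathbf{x}^{(3)}\in\mathcal{D}^{(3)}}\big(\mathbf{c}^{(3)}\mathbf{x}^{(3)}+\dots+\min_{\mathbf{x}^{(\beta)}\in\mathcal{D}^{(\beta)}}\mathbf{c}^{(\beta)}\mathbf{x}^{(\beta)}\big)\Big)\Big)$$ subject to $Q^{(1)}\mathbf{x}^{(1)}\in\mathcal{D}^{(1)}\ Q^{(2)}\mathbf{x}^{(2)}\in\mathcal{D}^{(2)}(\mathbf{x}^{(1)})\ \cdots\ Q^{(\beta)}\mathbf{x}^{(\beta)}\in\mathcal{D}^{(\beta)}(\mathbf{x}^{(1)},\dots,\mathbf{x}^{(\beta-1)}):\ A^\exists\mathbf{x}\le\mathbf{b}^\exists$. It is interpreted as a zero-sum game: blocks are set in order with full knowledge of the earlier blocks, existential blocks by a minimizing player and universal blocks by a maximizing player; the payoff of a complete play $\mathbf{x}$ is $\mathbf{c}\mathbf{x}$ if $A^\exists\mathbf{x}\le\mathbf{b}^\exists$ and $+\infty$ otherwise. A (winning) strategy for the existential player prescribes the assignment of each existential block as a function of the preceding blocks such that every resulting play against legal universal moves satisfies $A^\exists\mathbf{x}\le\mathbf{b}^\exists$. $P$ is feasible if a winning strategy exists; the value of a winning strategy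 is the maximum of $\mathbf{c}\mathbf{x}$ over its plays, and the optimal value of a feasible $P$ is the minimum value over all winning strategies (equivalently the min-max value of the game). **The $S$-relaxation.** For $S\subseteq\mathcal{L}_\forall$ let $\mathcal{L}_S=\{\mathbf{x}\in\mathcal{L}_{relax}\mid\mathbf{x}_\forall\in S\}$. The $S$-relaxation of $P$ is the problem $$\min_{\mathbf{x}^{(1)}\in\mathcal{L}_S^{(1)}}\Big(\mathbf{c}^{(1)}\mathbf{x}^{(1)}+\max_{\mathbf{x}^{(2)}\in\mathcal{L}_S^{(2)}}\Big(\mathbf{c}^{(2)}\mathbf{x}^{(2)}+\min_{\mathbf{x}^{(3)}\in\mathcal{L}_S^{(3)}}\big(\mathbf{c}^{(3)}\mathbf{x}^{(3)}+\dots+\min_{\mathbf{x}^{(\beta)}\in\mathcal{L}_S^{(\beta)}}\mathbf{c}^{(\beta)}\mathbf{x}^{(\beta)}\big)\Big)\Big)$$ subject to the quantified condition $Q^{(1)}\mathbf{x}^{(1)}\in\mathcal{L}_S^{(1)}\ \cdots\ Q^{(\beta)}\mathbf{x}^{(\beta)}\in\mathcal{L}_S^{(\beta)}:\ A^\exists\mathbf{x}\le\mathbf{b}^\exists$. Here, for existential blocks $\mathcal{L}_S^{(i)}=\mathcal{L}_{relax}^{(i)}$ (existential variables are continuous), and for universal blocks $\mathcal{L}_S^{(i)}$, which depends on the previously set blocks, is the set of those $\mathbf{y}$ for which $(\mathbf{x}^{(1)},\dots,\mathbf{x}^{(i-1)},\mathbf{y})$ can be extended to an element of $\mathcal{L}_S$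 (i.e. the universal player may only follow initial parts of scenarios in $S$). Strategies, feasibility and optimal value of the $S$-relaxation are defined as for $P$, with these domains in place of the $\mathcal{D}^{(i)}$ (minima over continuous domains may be read as infima). *)

(* Defs.v *)
(* MathComp / MathComp-Analysis. *)
From HB Require Import structures.
From mathcomp Require Import all_boot all_order all_algebra.
From mathcomp Require Import classical_sets reals ereal.

Set Implicit Arguments.
Unset Strict Implicit.
Unset Printing Implicit Defensive.

Import Order.TTheory GRing.Theory Num.Theory.

Local Open Scope classical_set_scope.
Local Open Scope ring_scope.

Inductive quantifier := Ex | All.

Definition is_all (q : quantifier) : bool := if q is All then true else false.

Lemma is_allK : cancel is_all (fun b => if b then All else Ex).
Proof. by case. Qed.

HB.instance Definition _ := Equality.copy quantifier (can_type is_allK).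

(* Variables and blocks are numbered from 0. *)
Section Blocks.
Variables (n : nat) (Q : 'I_n -> quantifier).

(* The block of x_j is the number of quantifier changes up to position j;
   as 0 < k, ord_pred k is k - 1. *)
Definition block (j : 'I_n) : nat :=
  #|[set k : 'I_n | (0 < k <= j)%N && (Q (ord_pred k) != Q k)]%SET|.

Definition nblocks : nat := (\max_(j < n) (block j).+1)%N.

Definition block_quant (i : nat) : quantifier :=
  if [exists j : 'I_n, (block j == i) && (Q j == All)] then All else Ex.

End Blocks.

(* Subvectors are finite functions on the selected index set. *)
Definition subvec (R : Type) (n : nat) (I : pred 'I_n) : Type :=
  {ffun {j : 'I_n | I j} -> R}.

Definition restrict (R : Type) (n : nat) (I : pred 'I_n) (x : 'cV[R]_n) :
  subvec R I := [ffun j => x (val j) ord0].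

Definition in_block n (Q : 'I_n -> quantifier) (i : nat) : pred 'I_n :=
  fun j => block Q j == i.

Definition before_block n (Q : 'I_n -> quantifier) (i : nat) : pred 'I_n :=
  fun j => (block Q j < i)%N.

Definition universal n (Q : 'I_n -> quantifier) : pred 'I_n :=
  fun j => Q j == All.

Definition linsys (R : realType) (m n : nat) (A : 'M[rat]_(m, n))
    (b : 'cV[rat]_m) : set 'cV[R]_n :=
  [set x | forall i, (map_mx ratr A *m x) i ord0 <= ratr (b i ord0)].

(* The multistage game: dom i p is the set of legal choices for block i after
   the history p, feas the set of complete plays won by the existential player,
   c the objective. *)
Section Game.
Variables (R : realType) (n : nat) (Q : 'I_n -> quantifier).
Variable dom : forall i : nat,
  subvec R (before_block Q i) -> set (subvec R (in_block Q i)).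
Variables (feas : set 'cV[R]_n) (c : 'rV[rat]_n).

(* Only the components at existential blocks are ever used. *)
Definition strategy : Type := forall i : 'I_(nblocks Q),
  subvec R (before_block Q i) -> subvec R (in_block Q i).

Definition legal_strategy (s : strategy) : Prop :=
  forall i : 'I_(nblocks Q),
    block_quant Q i = Ex -> forall p, dom p (s i p).

Definition plays (s : strategy) : set 'cV[R]_n :=
  [set x | forall i : 'I_(nblocks Q),
     match block_quant Q i with
     | Ex => restrict (in_block Q i) x = s i (restrict (before_block Q i) x)
     | All => dom (restrict (before_block Q i) x) (restrict (in_block Q i) x)
     end].

Definition winning (s : strategy) : Prop :=
  legal_strategy s /\ plays s `<=` feas.

Definition feasible : Prop := exists s, winning s.

Definition objective (x : 'cV[R]_n) : R := (map_mx ratr c *m x) ord0 ord0.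

Definition strategy_value (s : strategy) : \bar R :=
  ereal_sup [set (objective x)%:E | x in plays s].

(* When the move sets are finite, the supremum above is a maximum and, if a
   winning strategy exists, the infimum below is a minimum. The value is +oo if
   there is no winning strategy. *)
Definition optimal_value : \bar R :=
  ereal_inf [set strategy_value s | s in winning].

End Game.

Record qip (n : nat) := QIP {
  quant : 'I_n -> quantifier;
  lower : 'I_n -> rat;
  upper : 'I_n -> rat;
  cost : 'rV[rat]_n;
  ex_rows : nat;
  ex_mx : 'M[rat]_(ex_rows, n);
  ex_rhs : 'cV[rat]_ex_rows;
  all_rows : nat;
  all_mx : 'M[rat]_(all_rows, n);
  all_rhs : 'cV[rat]_all_rows
}.

Section QIP.
Variables (R : realType) (n : nat) (P : qip n).
Local Notation Q := (quant P).

Definition Lrelax_var (j : 'I_n) : set R :=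
  [set y | ratr (lower P j) <= y <= ratr (upper P j)].

Definition L_var (j : 'I_n) : set R :=
  [set y | y \is a Num.int /\ Lrelax_var j y].

Definition box (D : 'I_n -> set R) : set 'cV[R]_n :=
  [set x | forall j, D j (x j ord0)].

Definition box_block (D : 'I_n -> set R) (i : nat) :
    set (subvec R (in_block Q i)) :=
  [set y | forall j, D (val j) (y j)].

Definition legal : set 'cV[R]_n :=
  box L_var `&` linsys (all_mx P) (all_rhs P).

Definition uncertainty_set : set (subvec R (universal Q)) :=
  restrict (universal Q) @` legal.

(* Choices for block i after the history p that extend to an element of X. *)
Definition extendable (X : set 'cV[R]_n) (i : nat)
    (p : subvec R (before_block Q i)) : set (subvec R (in_block Q i)) :=
  [set y | exists x, [/\ X x, restrict (before_block Q i) x = p &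
                              restrict (in_block Q i) x = y]].

Definition qip_dom (i : nat) (p : subvec R (before_block Q i)) :
    set (subvec R (in_block Q i)) :=
  match block_quant Q i with
  | Ex => @box_block L_var i
  | All => @box_block L_var i `&` extendable legal p
  end.

Definition LS (S : set (subvec R (universal Q))) : set 'cV[R]_n :=
  [set x | box Lrelax_var x /\ S (restrict (universal Q) x)].

Definition srelax_dom (S : set (subvec R (universal Q))) (i : nat)
    (p : subvec R (before_block Q i)) : set (subvec R (in_block Q i)) :=
  match block_quant Q i with
  | Ex => @box_block Lrelax_var i
  | All => extendable (LS S) p
  end.

Definition qip_feasible : Prop :=
  feasible qip_dom (linsys (ex_mx P) (ex_rhs P)).

Definition qip_value : \bar R :=
  optimal_value qip_dom (linsys (ex_mx P) (ex_rhs P)) (cost P).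

Definition srelax_value (S : set (subvec R (universal Q))) : \bar R :=
  optimal_value (srelax_dom S) (linsys (ex_mx P) (ex_rhs P)) (cost P).

(* Standing assumptions on a QIP with polyhedral uncertainty. *)
Definition qip_wf : Prop :=
  [/\ (0 < n)%N,
      forall j, exists y : int, lower P j <= y%:~R <= upper P j,
      block_quant Q 0 = Ex /\ block_quant Q (nblocks Q).-1 = Ex,
      forall k j, Q j = Ex -> all_mx P k j = 0
    & uncertainty_set !=set0].

End QIP.

Arguments uncertainty_set {R n} P.
Arguments srelax_value {R n} P S.
Arguments qip_dom R {n} P [i] p.
Arguments srelax_dom {R n} P S [i] p.

(* Main.v *)
(* A winning strategy s of P is also winning in the S-relaxation, where it has
   no more plays than in P. Indeed, let x be a play of s in the relaxation. Its
   existential entries are chosen by s, hence integral. When a universal move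
   of x follows a scenario of S, replacing the universal entries of x by that
   scenario gives a legal vector, since the universal system ignores
   existential entries; so the move is legal in P. *)
Require Import Defs.
From mathcomp Require Import all_boot all_order all_algebra.
From mathcomp Require Import classical_sets reals ereal.

Set Implicit Arguments.
Unset Strict Implicit.
Unset Printing Implicit Defensive.

Import Order.TTheory GRing.Theory Num.Theory.

Local Open Scope classical_set_scope.
Local Open Scope ring_scope.

Section BlockTheory.
Variables (n : nat) (Q : 'I_n -> quantifier).

(** For [j <= j'], the quantifier changes up to [j] are among those up to [j']. Equal block numbers
    make these two sets equal, so no change occurs between [j] and [j']. *)
Lemma block_quantifier_eq (j j' : 'I_n) :
  block Q j = block Q j' -> Q j = Q j'.
Proof.
wlog le_jj' : j j' / (j <= j')%N.
  by move=> wl; case: (leqP j j') => [|/ltnW] le_j /esym eqb; [|symmetry];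
    apply: wl.
move=> eqb.
pose changes (i : 'I_n) :=
  [set k : 'I_n | (0 < k <= i)%N && (Q (ord_pred k) != Q k)]%SET.
have eq_changes : changes j = changes j'.
  apply/eqP; rewrite eqEcard {2}/changes -/(block Q j') -eqb leqnn andbT.
  apply/fintype.subsetP => k; rewrite !inE => /andP[/andP[-> le_kj] ->].
  by rewrite (leq_trans le_kj le_jj').
have Q_const d (k : 'I_n) : (k = j + d :> nat)%N -> (k <= j')%N -> Q k = Q j.
  elim: d k => [|d IHd] k def_k le_kj'.
    by congr Q; apply: val_inj; rewrite /= def_k addn0.
  have k_gt0 : (0 < k)%N by rewrite def_k addnS.
  have def_pred : (ord_pred k = j + d :> nat)%N.
    (* [ord_pred] is computed modulo [n]; it does not wrap around because [0 < k]. *)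
    rewrite /= -subn1 -addnBAC // modnDr modn_small ?def_k ?addnS ?subn1 //.
    by rewrite (leq_ltn_trans _ (ltn_ord k)) // def_k addnS.
  rewrite -(IHd (ord_pred k)) //; last first.
    by rewrite def_pred (leq_trans _ le_kj') // def_k addnS.
  (* A change at [k] would belong to [changes j], although [k] lies beyond [j]. *)
  apply/esym/eqP; apply: contraTT isT => neqQ.
  have : k \in changes j by rewrite eq_changes inE k_gt0 le_kj' neqQ.
  by rewrite inE def_k -addSnnS [(_ <= j)%N]leqNgt leq_addr andbF.
by rewrite (Q_const (j' - j)%N j') // subnKC.
Qed.

(** [block_quant] only tests for some universal variable in the block, which decides all of them
    since a block has a single quantifier. *)
Lemma block_quant_block (j : 'I_n) : block_quant Q (block Q j) = Q j.
Proof.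
rewrite /block_quant; case: existsP => [[k /andP[/eqP eqb /eqP <-]]|noAll].
  exact: block_quantifier_eq.
case defQ: (Q j) => //; case: noAll.
by exists j; rewrite defQ !eqxx.
Qed.

Lemma block_lt_nblocks (j : 'I_n) : (block Q j < nblocks Q)%N.
Proof. exact: (leq_bigmax j). Qed.

End BlockTheory.

Lemma restrict_eqP (R : Type) (n : nat) (I : pred 'I_n) (x y : 'cV[R]_n) :
  restrict I x = restrict I y <-> (forall j, I j -> x j ord0 = y j ord0).
Proof.
split=> [/ffunP eqxy j Ij | eqxy].
  by have := eqxy (exist _ j Ij); rewrite !ffunE.
by apply/ffunP => -[j Ij]; rewrite !ffunE eqxy.
Qed.

Section Relaxation.
Variables (R : realType) (n : nat) (P : qip n).
Local Notation Q := (quant P).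
Variable S : set (subvec R (universal Q)).

Lemma legal_strategy_srelax (s : strategy R Q) :
  legal_strategy (@qip_dom R n P) s -> legal_strategy (@srelax_dom R n P S) s.
Proof.
move=> legal_s i Qi p; have := legal_s i Qi p.
by rewrite /qip_dom /srelax_dom Qi => Ls j; have [] := Ls j.
Qed.

Lemma srelax_play_integral (s : strategy R Q) (x : 'cV[R]_n) (j : 'I_n) :
  legal_strategy (@qip_dom R n P) s -> plays (@srelax_dom R n P S) s x ->
  Q j = Ex -> L_var P j (x j ord0).
Proof.
move=> legal_s play_x Qj.
pose i : 'I_(nblocks Q) := Ordinal (block_lt_nblocks Q j).
have Qi : block_quant Q i = Ex by rewrite /= block_quant_block.
have := play_x i; rewrite Qi => x_i.
(* Legality is required at every history, hence also at one reached in the relaxation. *)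
have := legal_s i Qi (restrict (before_block Q i) x).
rewrite /qip_dom Qi -x_i => /(_ (exist _ j (eqxx _))).
by rewrite ffunE.
Qed.

Lemma legal_replace_scenario (x w : 'cV[R]_n) :
  (forall k j, Q j = Ex -> all_mx P k j = 0) ->
  (forall j, Q j = Ex -> L_var P j (x j ord0)) -> legal P w ->
  legal P (\col_j if Q j == All then w j ord0 else x j ord0).
Proof.
move=> A_ex x_int [w_box w_sys]; split=> [j|k].
  by rewrite mxE; case Qj: (Q j) => /=; [apply: x_int | apply: w_box].
(* Each row takes the same value on the mixed vector as on [w]: the terms differ only where the
   coefficient is zero. *)
have := w_sys k; rewrite !mxE; congr (is_true (_ <= _)).
apply: eq_bigr => j _; rewrite !mxE.
by case Qj: (Q j) => //=; rewrite A_ex // rmorph0 !mul0r.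
Qed.

Lemma plays_srelax_sub (s : strategy R Q) :
  (forall k j, Q j = Ex -> all_mx P k j = 0) -> S `<=` uncertainty_set P ->
  legal_strategy (@qip_dom R n P) s ->
  plays (@srelax_dom R n P S) s `<=` plays (@qip_dom R n P) s.
Proof.
move=> A_ex sub_S legal_s x play_x i; have := play_x i.
case Qi: (block_quant Q i) => //; rewrite /srelax_dom /qip_dom Qi.
case=> y [[_ /sub_S [w legal_w /restrict_eqP w_y]]].
move=> /restrict_eqP y_before /restrict_eqP y_in.
(* [y] may be fractional at later existential entries, so these are taken from [x]. On the history
   and on block [i], [w] agrees with [y] at universal entries and [y] agrees with [x], so [z] agrees
   with [x] there. *)
pose z := \col_j (if Q j == All then w j ord0 else x j ord0).
have legal_z : legal P z.
  apply: legal_replace_scenario => // j.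
  exact: srelax_play_integral legal_s play_x.
have z_x (I : pred 'I_n) : (forall j, I j -> y j ord0 = x j ord0) ->
    restrict I z = restrict I x.
  move=> y_x; apply/restrict_eqP => j Ij; rewrite mxE.
  by case: ifP => // Qj; rewrite w_y // y_x.
split; last by exists z; split=> //; apply: z_x.
by rewrite -(z_x _ y_in) => j; rewrite ffunE; case: legal_z.
Qed.

End Relaxation.

Theorem proposition5 (R : realType) (n : nat) (P : qip n)
    (S : set (subvec R (universal (quant P)))) :
  qip_wf R P ->
  qip_feasible R P ->
  (S !=set0)%classic ->
  (S `<=` uncertainty_set P)%classic ->
  (srelax_value P S <= qip_value R P)%E.
Proof.
move=> [_ _ _ A_ex _] _ _ sub_S.
apply: le_ereal_inf_tmp => _ [s [legal_s win_s] <-].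
have sub_plays := plays_srelax_sub A_ex sub_S legal_s.
apply: (@le_trans _ _
  (strategy_value (@srelax_dom R n P S) (cost P) s)); last first.
  (* Fewer plays give a smaller supremum. *)
  by apply: ereal_sup_le; apply: image_subset.
apply: ereal_inf_lbound; exists s => //; split.
  exact: legal_strategy_srelax.
exact: subset_trans win_s.
Qed.
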